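(* The following problem $\mathrm{RightIdentities}$ can be computed in polynomial time. Input: transformations $a_1,\dots,a_k\in T_n$. Problem: enumerate (output the list of all) right identities of $\langle a_1,\dots,a_k\rangle$.
   Context: $T_n$ is the full transformation semigroup on $[n]=\{1,\dots,n\}$: all maps $[n]\to[n]$, acting on the right, under composition (so $q\cdot st=(qs)t$). $\langle a_1,\dots,a_k\rangle$ is the subsemigroup of $T_n$ generated by $a_1,\dots,a_k$ ($k,n\ge 1$). In the input and output each transformation is given by its table of values; $k,n$ are part of the input. An element $r$ of a semigroup $S$ is a right identity if $sr=s$ for all $s\in S$. *)

(* Defs.v *)
From HB Require Import structures.
From mathcomp Require Import all_boot all_algebra.

Set Implicit Arguments.
Unset Strict Implicit.
Unset Printing Implicit Defensive.

(* Maps [n] -> [n] acting on the right: q.(st) = (q.s).t.  A separate constant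
   is used because {ffun _ -> _} carries the pointwise product by default. *)
Definition transf (n : nat) : Type := {ffun 'I_n -> 'I_n}.
HB.instance Definition _ n := Finite.on (transf n).

Definition transf_comp n (s t : transf n) : transf n :=
  [ffun q : 'I_n => t (s q)].

Lemma transf_compA n : associative (@transf_comp n).
Proof. by move=> s t u; apply/ffunP=> q; rewrite !ffunE. Qed.

HB.instance Definition _ n := isSemigroup.Build (transf n) (@transf_compA n).

Inductive subsemigroup_gen (S : semigroupType) (A : seq S) : S -> Prop :=
| Gen_base a : a \in A -> subsemigroup_gen A a
| Gen_mul s t :
    subsemigroup_gen A s -> subsemigroup_gen A t -> subsemigroup_gen A (s * t)%g.

Definition right_identity (S : semigroupType) (U : S -> Prop) (r : S) : Prop :=
  U r /\ forall s, U s -> (s * r)%g = s.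

Variant direction := MoveLeft | Stay | MoveRight.

(* A deterministic Turing machine with finitely many two-way infinite tapes,
   over the input/output alphabet A.  A cell holds an element of A, one of the
   machine's own symbols, or a blank (None). *)
Record machine (A : finType) := Machine {
  work_symbol : finType;
  tape_name : finType;
  state : finType;
  input_tape : tape_name;
  output_tape : tape_name;
  start : state;
  halting : {pred state};
  transition :
    state -> {ffun tape_name -> option (A + work_symbol)} ->
    state * {ffun tape_name -> option (A + work_symbol) * direction}
}.

Arguments start {A} m.
Arguments halting {A} m.
Arguments transition {A} m _ _.

Section Run.
Variables (A : finType) (M : machine A).

Definition symbol : Type := option (A + work_symbol M).

(* Cells are indexed relative to the head, which always scans cell 0. *)
Definition tape : Type := int -> symbol.

Definition update_tape (t : tape) (a : symbol * direction) : tape :=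
  let t' z := if z == 0%R then a.1 else t z in
  match a.2 with
  | MoveLeft => fun z => t' (z - 1)%R
  | Stay => t'
  | MoveRight => fun z => t' (z + 1)%R
  end.

(* The word w on an otherwise blank tape, with the head on its first letter. *)
Definition word_tape (w : seq A) : tape :=
  fun z => if z is Posz i then omap inl (onth w i) else None.

Definition config : Type := state M * (tape_name M -> tape).

Definition init (w : seq A) : config :=
  (start M, fun i => word_tape (if i == input_tape M then w else [::])).

Definition step (c : config) : config :=
  if c.1 \in halting M then c else
  let a := transition M c.1 [ffun i => c.2 i 0%R] in
  (a.1, fun i => update_tape (c.2 i) (a.2 i)).

Definition halts_with_output (w v : seq A) (time : nat) : Prop :=
  exists2 m, m <= time &
    let c := iter m step (init w) in
    c.1 \in halting M /\ c.2 (output_tape M) =1 word_tape v.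

End Run.

(* A computation problem is given by its instances x : I, the possible answers
   y : O x, the relation "y is a correct answer for x", and encodings of both
   over a common finite alphabet. *)
Definition computable_in_poly_time (A : finType) (I : Type) (O : I -> Type)
    (encode_in : I -> seq A) (encode_out : forall x, O x -> seq A)
    (correct : forall x, O x -> Prop) : Prop :=
  exists (M : machine A) (p : {poly nat}), forall x : I,
    exists2 y : O x, correct x y &
      halts_with_output M (encode_in x) (encode_out x y)
        p.[size (encode_in x)]%R.

Variant letter := Bit of bool | Comma | Semicolon.

Definition option_of_letter (l : letter) : option (option bool) :=
  match l with
  | Bit b => Some (Some b)
  | Comma => Some None
  | Semicolon => None
  end.
Definition letter_of_option (o : option (option bool)) : letter :=
  match o with
  | Some (Some b) => Bit b
  | Some None => Comma
  | None => Semicolon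
  end.
Lemma option_of_letterK : cancel option_of_letter letter_of_option.
Proof. by case. Qed.
HB.instance Definition _ := Finite.copy letter (can_type option_of_letterK).

(* Binary expansion, most significant bit first, no leading zeros for m > 0. *)
Definition binary (m : nat) : seq letter :=
  [seq Bit (odd (m %/ 2 ^ i)) | i <- rev (iota 0 (trunc_log 2 m).+1)].

(* The table q.1, ..., q.n of values; i : 'I_n stands for the point i.+1 of
   {1, ..., n}. *)
Definition encode_table n (s : transf n) : seq letter :=
  rcons (flatten [seq rcons (binary (s q).+1) Comma | q <- enum 'I_n]) Semicolon.

Definition encode_tables n (l : seq (transf n)) : seq letter :=
  flatten [seq encode_table s | s <- l].

Record generators := Generators {
  ngen : nat;
  degree : nat;
  ngen_gt0 : 0 < ngen;
  degree_gt0 : 0 < degree;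
  gens : ngen.-tuple (transf degree)
}.

Definition encode_generators (x : generators) : seq letter :=
  rcons (binary (ngen x)) Semicolon ++ rcons (binary (degree x)) Semicolon ++
  encode_tables (gens x).

Definition lists_right_identities (x : generators)
    (l : seq (transf (degree x))) : Prop :=
  uniq l /\
  forall r, r \in l <-> right_identity (subsemigroup_gen (gens x)) r.

(* Main.v *)
(* Let I be the union of the images of the generators.  A right identity r fixes
   I pointwise, and r = s g for some generator s, so that s is injective on I
   and r is determined by s: it maps q to the unique p in I with p.s = q.s.
   Conversely, if s is injective on I, it permutes I, so some power of s is the
   identity on I, and this power is a right identity.  Hence there is at most
   one right identity for each generator, given by an explicit formula.

   For the running time, Turing machines are programmed as machines with stacks
   of letters: a tape with the head on the first letter of w is a stack
   containing w.  The word functions computable in polynomial time are closed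
   under primitive recursion on words provided that each step increases the
   length of the result by an amount that does not depend on the result; all
   parts of the algorithm are instances of this scheme. *)
Require Import Defs.
From HB Require Import structures.
From Stdlib Require Import FunctionalExtensionality.
From mathcomp Require Import all_boot all_algebra zify.

Set Implicit Arguments.
Unset Strict Implicit.
Unset Printing Implicit Defensive.

Notation word := (seq letter).
Definition store := nat -> word.
Definition upd (s : store) x w : store := fun y => if y == x then w else s y.

(** * Stack programs and their compilation *)

(* Loop x p pops x until it is empty and runs p a for each popped letter a. *)
Inductive prog :=
| Skip
| Push of nat & letter
| Seq of prog & prog
| Loop of nat & (letter -> prog).

(** The number bounds the steps of the compiled machine: a push costs two, each test of a loop
    one. *)
Inductive runs : prog -> store -> nat -> store -> Prop :=
| RSkip s : runs Skip s 1 s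
| RPush x a s : runs (Push x a) s 2 (upd s x (a :: s x))
| RSeq p q s s' s'' t t' :
    runs p s t s' -> runs q s' t' s'' -> runs (Seq p q) s (t + t') s''
| RLoop0 x p s : s x = [::] -> runs (Loop x p) s 1 s
| RLoop x p s s' s'' a w t t' :
    s x = a :: w -> runs (p a) (upd s x w) t s' ->
    runs (Loop x p) s' t' s'' -> runs (Loop x p) s (1 + t + t') s''.

Section Compile.
Variable K : nat.

Definition sym : Type := option (letter + void).
Definition cells : Type := {ffun 'I_K.+1 -> sym}.
Definition action : Type := {ffun 'I_K.+1 -> sym * direction}.

(** In a loop, [None] is the test at its head; the sigma type lets the state remember the popped
    letter, on which the body depends. *)
Fixpoint prog_state (p : prog) : finType :=
  match p with
  | Skip => unit
  | Push _ _ => bool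
  | Seq p q => (prog_state p + prog_state q)%type
  | Loop _ p => option {a : letter & prog_state (p a)}
  end.

Fixpoint entry (p : prog) : prog_state p :=
  match p with
  | Skip => tt
  | Push _ _ => false
  | Seq p _ => inl (entry p)
  | Loop _ _ => None
  end.

Definition keep (r : cells) : action := [ffun i => (r i, Stay)].

(* Push takes two steps: the head has to move to the blank cell in front of the
   stack before it can write. *)
Fixpoint prog_transition (p : prog) :
    prog_state p -> cells -> option (prog_state p) * action :=
  match p return prog_state p -> cells -> option (prog_state p) * action with
  | Skip => fun _ r => (None, keep r)
  | Push x a => fun q r =>
      if q then
        (None, [ffun i => (if i == inord x then Some (inl a) else r i, Stay)])
      else
        (Some true,
         [ffun i => (r i, if i == inord x then MoveLeft else Stay)])
  | Seq p q => fun st r =>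
      match st with
      | inl u => let a := prog_transition u r in
          (Some (if a.1 is Some u' then inl u' else inr (entry q)), a.2)
      | inr v => let a := prog_transition v r in (omap inr a.1, a.2)
      end
  | Loop x p => fun st r =>
      match st with
      | None =>
          match r (inord x) with
          | Some (inl a) =>
              (Some (Some (existT (fun a => prog_state (p a)) a (entry (p a)))),
               [ffun i =>
                  if i == inord x then (None, MoveRight) else (r i, Stay)])
          | _ => (None, keep r)
          end
      | Some (existT a u) => let b := prog_transition u r in
          (Some (omap (existT (fun a => prog_state (p a)) a) b.1), b.2)
      end
  end.

(** [None] is the only halting state. Tape 0 is the input; [inord 1] denotes tape 1 only if K is
    positive. *)
Definition machine_of (p : prog) : machine letter :=
  @Machine letter void 'I_K.+1 (option (prog_state p)) ord0 (inord 1)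
    (Some (entry p)) (pred1 None)
    (fun q r => if q is Some q then prog_transition q r else (None, keep r)).

Notation pstep p := (@step letter (machine_of p)).
Notation tapes p := ('I_K.+1 -> tape (machine_of p)).

Fixpoint vars_le (p : prog) : Prop :=
  match p with
  | Skip => True
  | Push x _ => x <= K
  | Seq p q => vars_le p /\ vars_le q
  | Loop x p => x <= K /\ forall a, vars_le (p a)
  end.

Definition represents (T : 'I_K.+1 -> int -> sym) (s : store) :=
  forall i z, T i z = if z is Posz j then omap inl (onth (s i) j) else None.

(** The step that would halt p enters q instead. Only t' <= t holds, because p may have halted early
    and idled in [None]. *)
Lemma iter_seq_l p q t u (T T' : tapes p) :
  iter t (pstep p) (Some u, T) = (None, T') ->
  exists2 t', t' <= t &
    iter t' (pstep (Seq p q)) (Some (inl u), T) = (Some (inr (entry q)), T').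
Proof.
elim: t u T => [//|t IH] u T; rewrite iterSr.
rewrite {2}/step /= /in_mem /=.
case E: (prog_transition u _) => [[u'|] act] /=.
  move/IH => [t' le_t' eq_t']; exists t'.+1; first exact: le_t'.
  by rewrite iterSr [pstep _ (_,_)]/step /= /in_mem /= E.
have -> S : iter t (pstep p) (None, S) = (None, S).
  by elim: t {IH} => //= t ->; rewrite /step /= /in_mem /=.
move=> [<-]; exists 1 => //=; by rewrite /step /= /in_mem /= E.
Qed.

Lemma iter_seq_r p q t u (T T' : tapes q) :
  iter t (pstep q) (Some u, T) = (None, T') ->
  iter t (pstep (Seq p q)) (Some (inr u), T) = (None, T').
Proof.
elim: t u T => [//|t IH] u T; rewrite !iterSr.
rewrite {2}/step {3}/step /= /in_mem /=.
case E: (prog_transition u _) => [[u'|] act] /=; first by move/IH.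
have -> S : iter t (pstep q) (None, S) = (None, S).
  by elim: t {IH} => //= t ->; rewrite /step /= /in_mem /=.
by move=> [<-]; elim: t {IH} => //= t ->; rewrite /step /= /in_mem /=.
Qed.

Lemma iter_loop x p a t u (T T' : tapes (p a)) :
  iter t (pstep (p a)) (Some u, T) = (None, T') ->
  exists2 t', t' <= t &
    iter t' (pstep (Loop x p)) (Some (Some (existT _ a u)), T) =
      (Some None, T').
Proof.
elim: t u T => [//|t IH] u T; rewrite iterSr.
rewrite {2}/step /= /in_mem /=.
case E: (prog_transition u _) => [[u'|] act] /=.
  move/IH => [t' le_t' eq_t']; exists t'.+1; first exact: le_t'.
  by rewrite iterSr [pstep _ (_,_)]/step /= /in_mem /= E.
have -> S : iter t (pstep (p a)) (None, S) = (None, S).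
  by elim: t {IH} => //= t ->; rewrite /step /= /in_mem /=.
move=> [<-]; exists 1 => //=; by rewrite /step /= /in_mem /= E.
Qed.

Lemma represents_keep p (T : tapes p) s (r : cells) :
  r = [ffun i => T i 0%R] -> represents T s ->
  represents (fun i => update_tape (T i) (keep r i)) s.
Proof.
move=> -> hT i z; rewrite -hT /update_tape !ffunE /=.
by case: eqP => // ->.
Qed.

Lemma inord_inj (i : 'I_K.+1) x : x <= K -> (i == inord x) = (i == x :> nat).
Proof. by move=> le_x; rewrite -val_eqE /= inordK. Qed.

Lemma runs_machine p s t s' : runs p s t s' -> vars_le p ->
  forall T : tapes p, represents T s ->
  exists T' : tapes p, represents T' s' /\
    exists2 t', t' <= t & iter t' (pstep p) (Some (entry p), T) = (None, T').
Proof.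
elim=> {p s t s'}.
- move=> s _ T hT; eexists; split; last first.
    by exists 1 => //=; rewrite /step /= /in_mem /=.
  exact: represents_keep hT.
- move=> x a s le_x T hT; eexists; split; last first.
    by exists 2 => //=; rewrite /step /= /in_mem /=.
  move=> i z; rewrite /= /update_tape !ffunE inord_inj //= /upd.
  case: (i =P x :> nat) => Ei /=; last first.
    case: eqP => [->|nz] /=; first by rewrite hT.
    by rewrite hT.
  case: eqP => [->|nz] //.
  case: eqP => [E|nz'].
    by rewrite (_ : z = Posz 1) ?hT ?Ei //; lia.
  case: z nz nz' => [[|j]|j] // nz nz'.
    by rewrite (_ : Posz j.+1 - 1 = Posz j)%R ?hT ?Ei //; lia.
  by rewrite (_ : Negz j - 1 = Negz j.+1)%R ?hT //; lia.
- move=> p q s s' s'' t t' _ IHp _ IHq [vp vq] T hT.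
  have [T1 [hT1 [t1 le_t1 /(iter_seq_l q) [t1' le_t1' e1]]]] := IHp vp T hT.
  have [T2 [hT2 [t2 le_t2 /(iter_seq_r p) e2]]] := IHq vq T1 hT1.
  exists T2; split=> //; exists (t2 + t1'); first by lia.
  by rewrite iterD e1.
- move=> x p s s0 [le_x vp] T hT; eexists; split; last first.
    exists 1 => //=; rewrite /step /= /in_mem /= ffunE hT inordK // s0 /=.
    by reflexivity.
  exact: represents_keep hT.
- move=> x p s s' s'' a w t t' sx _ IHp _ IHl [le_x vp] T hT.
  (* The tapes after the letter has been erased and the head of tape x has moved right. *)
  pose T0 := fun i => update_tape (M := machine_of (p a)) (T i)
     (if i == inord x then (None, MoveRight) else (T i 0%R, Stay)).
  have hT0 : represents T0 (upd s x w).
    move=> i z; rewrite /T0 /update_tape /= inord_inj // /upd.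
    case: (i =P x :> nat) => Ei /=; last first.
      by case: eqP => [->|nz]; rewrite hT.
    case: eqP => [E|nz]; first by rewrite (_ : z = Negz 0) //; lia.
    case: z nz => [j|[|j]] // nz.
      by rewrite (_ : Posz j + 1 = Posz j.+1)%R ?hT ?Ei ?sx //; lia.
    by rewrite (_ : Negz j.+1 + 1 = Negz j)%R ?hT //; lia.
  have [T1 [hT1 [t1 le_t1 /(iter_loop x) [t1' le_t1' e1]]]] := IHp (vp a) T0 hT0.
  have [T2 [hT2 [t2 le_t2 e2]]] := IHl (conj le_x vp) T1 hT1.
  exists T2; split=> //; exists (t2 + (t1' + 1)); first by lia.
  rewrite iterD iterD /= {3}/step /= /in_mem /= ffunE hT inordK // sx /=.
  rewrite -[X in iter t2 _ X]/(iter t1' _ _).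
  rewrite (_ : (fun i : 'I_K.+1 => _) = T0) ?e1 //.
  by apply: functional_extensionality => i; rewrite /T0 !ffunE.
Qed.

Lemma machine_of_correct p s t s' : vars_le p -> 1 <= K ->
  runs p s t s' -> (forall x, 0 < x -> s x = [::]) ->
  halts_with_output (machine_of p) (s 0) (s' 1) t.
Proof.
move=> vp K_gt0 rp s_clean.
have [|T' [hT' [t' le_t' eq_t']]] :=
  runs_machine rp vp (T := (init (machine_of p) (s 0)).2).
  move=> i z; rewrite /= -val_eqE /=.
  by case: eqP => [->|/eqP] //; rewrite -lt0n => /s_clean ->; case: z.
exists t' => //=; rewrite /init eq_t' /= /in_mem /=; split=> // z.
by rewrite hT' inordK.
Qed.

End Compile.

Lemma vars_le_trans K K' p : K <= K' -> vars_le K p -> vars_le K' p.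
Proof.
move=> le_KK'; elim: p => //=.
- by move=> x _ /leq_trans; apply.
- by move=> p IHp q IHq [/IHp ? /IHq ?].
- by move=> x p IH [/leq_trans le_x vp]; split; [exact: le_x | auto].
Qed.

(** The body of a loop is a family over the finite type of letters, so its bounds have a maximum. *)
Lemma vars_le_ex p : exists K, vars_le K p.
Proof.
elim: p => [|x a|p [K vK] q [L vL]|x p IH]; first by exists 0.
- by exists x => /=.
- exists (maxn K L); split.
    exact: vars_le_trans (leq_maxl _ _) vK.
  exact: vars_le_trans (leq_maxr _ _) vL.
have [K vK] := fin_all_exists IH.
exists (maxn x (\max_a K a)); split=> [|a]; first exact: leq_maxl.
apply: vars_le_trans (vK a); apply: leq_trans (leq_maxr _ _).
exact: leq_bigmax.
Qed.

(** * Polynomial time functions of stores *)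

Definition polyfun (B : nat -> nat) :=
  exists P : {poly nat}, forall n, B n = P.[n]%R.

Lemma polyfun_const c : polyfun (fun=> c).
Proof. by exists (c%:P)%R => n; rewrite hornerC. Qed.

Lemma polyfun_id : polyfun id.
Proof. by exists 'X%R => n; rewrite hornerX. Qed.

Lemma polyfun_add B C : polyfun B -> polyfun C -> polyfun (fun n => B n + C n).
Proof.
by move=> [P hP] [Q hQ]; exists (P + Q)%R => n; rewrite hornerD hP hQ.
Qed.

Lemma polyfun_mul B C : polyfun B -> polyfun C -> polyfun (fun n => B n * C n).
Proof.
by move=> [P hP] [Q hQ]; exists (P * Q)%R => n; rewrite hornerM hP hQ.
Qed.

Lemma polyfun_comp B C : polyfun B -> polyfun C -> polyfun (fun n => B (C n)).
Proof.
by move=> [P hP] [Q hQ]; exists (P \Po Q)%R => n; rewrite horner_comp hP hQ.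
Qed.

(** Serves as a common bound for one polynomial per letter; unlike a maximum, a sum stays
    polynomial. *)
Lemma polyfun_sum (I : finType) (B : I -> nat -> nat) :
  (forall i, polyfun (B i)) -> polyfun (fun n => \sum_i B i n).
Proof.
move=> /fin_all_exists [P hP]; exists (\sum_i P i)%R => n.
by rewrite horner_sum; apply: eq_bigr => i _; rewrite hP.
Qed.

(** The coefficients are natural numbers, so every Horner step is monotone. *)
Lemma polyfun_mono B : polyfun B -> {homo B : m n / m <= n}.
Proof.
move=> [P hP] m n le_mn; rewrite !hP; elim/poly_ind: P {hP} => [|P c IH].
  by rewrite !horner0.
by rewrite !hornerMXaddC; apply: leq_add => //; apply: leq_mul.
Qed.

Ltac polyfun := repeat first
  [ exact: polyfun_const | exact: polyfun_id | assumption
  | apply: polyfun_add | apply: polyfun_mul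
  | apply: polyfun_sum => ? | apply: polyfun_comp; first by [] ].

(** * Stack operations with time bounds *)

Definition within p s s' T := exists2 t, t <= T & runs p s t s'.

Lemma within_le p s s' T T' : T <= T' -> within p s s' T -> within p s s' T'.
Proof.
by move=> le_TT' [t le_t rt]; exists t => //; apply: leq_trans le_TT'.
Qed.

Lemma within_conv p s s1 s2 T T' :
  within p s s1 T -> s1 = s2 -> T <= T' -> within p s s2 T'.
Proof. by move=> w <- le_TT'; apply: within_le w. Qed.

Lemma within_seq p q s s' s'' T T' :
  within p s s' T -> within q s' s'' T' -> within (Seq p q) s s'' (T + T').
Proof.
move=> [t le_t rt] [t' le_t' rt']; exists (t + t'); first exact: leq_add.
exact: RSeq rt rt'.
Qed.

Lemma within_loop x p s s' s'' a w T T' :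
  s x = a :: w -> within (p a) (upd s x w) s' T -> within (Loop x p) s' s'' T' ->
  within (Loop x p) s s'' (1 + T + T').
Proof.
move=> sx [t le_t rt] [t' le_t' rt']; exists (1 + t + t'); first by lia.
exact: RLoop sx rt rt'.
Qed.

Lemma within_push x a s : within (Push x a) s (upd s x (a :: s x)) 2.
Proof. by exists 2 => //; constructor. Qed.

Ltac store_at := rewrite /upd;
  repeat case: (@eqP nat) => ?; subst; try (by []); try lia; try congruence.
Ltac store_eq := apply: functional_extensionality => ?; store_at.

Definition clear x := Loop x (fun=> Skip).
Lemma within_clear x s w :
  s x = w -> within (clear x) s (upd s x [::]) (2 * size w + 1).
Proof.
elim: w s => [|a w IH] s sx.
  exists 1 => //; have -> : upd s x [::] = s by store_eq.
  exact: RLoop0.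
apply: within_le (within_loop sx (s' := upd s x w) (T := 1) _ _).
- rewrite -/(clear x) /=.
  by apply: leq_trans (leqnn (1 + 1 + (2 * size w + 1))) _; lia.
- by exists 1 => //; constructor.
- have -> : upd s x [::] = upd (upd s x w) x [::] by store_eq.
  by apply: IH; rewrite /upd eqxx.
Qed.

Definition move x y := Loop x (Push y).
Lemma within_move x y s w : x != y -> s x = w ->
  within (move x y) s (upd (upd s x [::]) y (catrev w (s y))) (3 * size w + 1).
Proof.
move=> /eqP neq_xy; elim: w s => [|a w IH] s sx.
  exists 1 => //; rewrite (_ : upd _ _ _ = s); first exact: RLoop0.
  store_eq.
pose s1 := upd s x w; pose s2 := upd s1 y (a :: s1 y).
have h := IH s2; apply: within_le (within_loop sx (within_push y a s1) _).
  by apply: leq_trans (leqnn (1 + 2 + (3 * size w + 1))) _; rewrite /=; lia.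
rewrite (_ : upd (upd s x [::]) _ _ = upd (upd s2 x [::]) y (catrev w (s2 y))).
  by apply: IH; rewrite /s2 /s1 /upd eqxx; case: eqP.
rewrite /s2 /s1 /=; store_eq.
Qed.

(* Through the stack z, so that the order of letters is preserved. *)
Definition transfer x z y := Seq (move x z) (move z y).
Lemma within_transfer x z y s w :
  x != y -> x != z -> z != y -> s x = w -> s y = [::] -> s z = [::] ->
  within (transfer x z y) s (upd (upd s x [::]) y w) (6 * size w + 2).
Proof.
move=> xy xz zy sx sy sz.
have := within_move xz sx; rewrite sz.
set s1 := upd _ _ _ => h1.
have := @within_move z y s1 (rev w) zy; rewrite size_rev => h2.
rewrite (_ : upd (upd s x [::]) y _ =
             upd (upd s1 z [::]) y (catrev (rev w) (s1 y))).
  apply: within_le (within_seq h1 (h2 _)); first by lia.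
  by rewrite /s1 /upd eqxx catrevE cats0.
have -> : s1 y = [::].
  by rewrite /s1 /upd eq_sym (negbTE zy) sy; case: ifP.
move/eqP: xy => xy; move/eqP: xz => xz; rewrite catrevE revK cats0 /s1.
store_eq.
Qed.

(** * The class of polynomial time functions *)

Definition agree k (s s' : store) := forall x, x < k -> s x = s' x.
(** Stacks from k on are scratch space, empty before an evaluation and again after it, apart from
    the result on stack k. *)
Definition clean k (s : store) := forall x, k <= x -> s x = [::].
Definition tot k (s : store) := \sum_(i < k) size (s i).

Lemma tot_agree k s s' : agree k s s' -> tot k s = tot k s'.
Proof. by move=> e; apply: eq_bigr => i _; rewrite e. Qed.

Lemma totS k s : tot k.+1 s = tot k s + size (s k).
Proof. by rewrite /tot big_ord_recr. Qed.

Lemma leq_tot m k s : m <= k -> tot m s <= tot k s.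
Proof.
move/subnK <-; elim: (k - m) => // j IH.
by rewrite addSn totS; apply: leq_trans (leq_addr _ _).
Qed.

Lemma size_tot k s x : x < k -> size (s x) <= tot k s.
Proof. by move=> lt_xk; rewrite /tot (bigD1 (Ordinal lt_xk)) //= leq_addr. Qed.

Lemma tot_upd k s w : tot k.+1 (upd s k w) = tot k s + size w.
Proof.
rewrite totS /upd eqxx; congr addn; apply: tot_agree => x lt_xk.
by case: eqP lt_xk => // ->; rewrite ltnn.
Qed.

Lemma agree_upd k s w : agree k (upd s k w) s.
Proof. by move=> x; rewrite /upd; case: eqP => // ->; rewrite ltnn. Qed.

(* Every k >= m may serve as base of the scratch stacks, so that an evaluation
   can take place while stacks m, ..., k - 1 hold intermediate results. *)
Record polytime m (f : store -> word) : Prop := Polytime {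
  pt_local : forall s s', agree m s s' -> f s = f s';
  pt_size : exists2 B, polyfun B & forall s, size (f s) <= B (tot m s);
  pt_prog : forall k, m <= k -> exists p, exists2 B, polyfun B &
    forall s, clean k s -> within p s (upd s k (f s)) (B (tot k s)) }.

Lemma polytime_weak m k f : m <= k -> polytime m f -> polytime k f.
Proof.
move=> le_mk [loc [B pB sz] pr]; split.
- by move=> s s' ag; apply: loc => x /leq_trans lt_x; apply/ag/lt_x.
- exists B => // s.
  exact: leq_trans (sz s) (polyfun_mono pB (leq_tot s le_mk)).
- by move=> j le_kj; apply: pr; apply: leq_trans le_kj.
Qed.

Lemma polytime_ext m f g : f =1 g -> polytime m f -> polytime m g.
Proof. by move=> /functional_extensionality ->. Qed.

Lemma polytime_nil m : polytime m (fun=> [::]).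
Proof.
split=> //; first by exists (fun=> 0) => //; polyfun.
move=> k _; exists Skip, (fun=> 1); first by polyfun.
move=> s cl; exists 1 => //; rewrite (_ : upd _ _ _ = s); first by constructor.
by apply: functional_extensionality => y; rewrite /upd; case: eqP => // ->;
  rewrite cl.
Qed.

Lemma polytime_cons m a f : polytime m f -> polytime m (fun s => a :: f s).
Proof.
move=> [loc [B pB sz] pr]; split.
- by move=> s s' ag; rewrite (loc s s').
- by exists (fun n => B n + 1) => [|s /=]; [polyfun | rewrite addn1 ltnS].
move=> k /pr [p [C pC hp]]; exists (Seq p (Push k a)), (fun n => C n + 2).
  by polyfun.
move=> s cl; apply: within_seq (hp s cl) _.
rewrite (_ : upd s k (a :: f s) =
  upd (upd s k (f s)) k (a :: upd s k (f s) k)); first exact: within_push.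
by rewrite /(upd s k _ k) eqxx; store_eq.
Qed.

Lemma polytime_const m w : polytime m (fun=> w).
Proof. by elim: w => [|a w]; [exact: polytime_nil | exact: polytime_cons]. Qed.

(** Reading a stack destroys it. The word is therefore moved to stack k + 1, and from there each
    letter is pushed both back on x and onto k; the two reversals cancel. *)
Lemma polytime_var m x : x < m -> polytime m (fun s => s x).
Proof.
move=> lt_xm; split; first by move=> s s'; apply.
  by exists id => [|s]; [polyfun | exact: size_tot].
move=> k le_mk; have lt_xk := leq_trans lt_xm le_mk.
pose copy := Loop k.+1 (fun a => Seq (Push x a) (Push k a)).
exists (Seq (move x k.+1) copy), (fun n => 8 * n + 2); first by polyfun.
move=> s cl.
have hcopy w : forall s', s' k.+1 = w ->
  within copy s' (upd (upd (upd s' k.+1 [::]) x (catrev w (s' x)))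
                      k (catrev w (s' k))) (5 * size w + 1).
  elim: w => [|a w IH] s' s'w.
    exists 1 => //; rewrite (_ : upd _ _ _ = s'); first exact: RLoop0.
    store_eq.
  have h1 := within_push x a (upd s' k.+1 w).
  have h2 := within_push k a (upd (upd s' k.+1 w) x (a :: upd s' k.+1 w x)).
  have h3 := IH (upd (upd (upd s' k.+1 w) x (a :: upd s' k.+1 w x))
    k (a :: upd (upd s' k.+1 w) x (a :: upd s' k.+1 w x) k)).
  apply: within_conv (within_loop s'w (within_seq h1 h2) (h3 _)) _ _.
  - by store_at.
  - by rewrite /=; store_eq.
  - by rewrite /=; lia.
have neq_x : x != k.+1 by lia.
set s1 := upd (upd s x [::]) k.+1 (catrev (s x) (s k.+1)).
have hc := hcopy (rev (s x)) s1.
apply: within_conv (within_seq (within_move neq_x (erefl (s x))) (hc _)) _ _.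
- by rewrite /s1 /upd eqxx (cl k.+1).
- rewrite /s1 !(cl k.+1) // !catrevE !revK !cats0; store_eq.
  + by rewrite (cl k) // cats0.
  + by rewrite cats0.
  + by rewrite (cl k.+1).
- rewrite size_rev; have := size_tot s lt_xk; lia.
Qed.

(** * Primitive recursion on words with bounded growth *)

Fixpoint prec T (h : letter -> word -> T -> T) e w :=
  if w is a :: w' then h a w' (prec h e w') else e.

(** Since the increment does not depend on c, increments add up over the letters instead of
    compounding. *)
Lemma size_prec (h : letter -> word -> word -> word) e w D :
  {homo D : m n / m <= n} ->
  (forall a v c, size (h a v c) <= size c + D (size v)) ->
  size (prec h e w) <= size e + size w * D (size w).
Proof.
move=> monoD hD; elim: w => [|a w IH] /=; first by rewrite addn0.
apply: leq_trans (hD a w _) _; apply: leq_trans (leq_add IH (leqnn _)) _.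
rewrite -addnA leq_add2l mulSn addnC.
by rewrite leq_add ?leq_mul //; apply: monoD.
Qed.

(** Computability of a step with two word arguments, stated through substitution because programs
    only see a store. Letting k exceed m allows arguments held on further stacks. *)
Definition closed_op m (h : store -> word -> word -> word) :=
  forall k f g, m <= k -> polytime k f -> polytime k g ->
    polytime k (fun s => h s (f s) (g s)).

(* The bound rules out results that grow by a factor in every step. *)
Definition additive m (h : store -> word -> word -> word) :=
  exists2 D, polyfun D &
    forall s w c, size (h s w c) <= size c + D (tot m s + size w).

Lemma closed_local m h s s' w c : closed_op m h -> agree m s s' ->
  h s w c = h s' w c.
Proof.
move=> cl; apply: (pt_local (cl m (fun=> w) (fun=> c) (leqnn m) _ _));
exact: polytime_const.
Qed.

Section Prec.
Variables (m : nat) (f e : store -> word).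
Variable h : letter -> store -> word -> word -> word.
Hypotheses (pf : polytime m f) (pe : polytime m e).
Hypothesis hcl : forall a, closed_op m (h a).
Hypothesis hadd : forall a, additive m (h a).

Let g s := prec (fun a => h a s) (e s) (f s).

Let g_local s s' : agree m s s' -> g s = g s'.
Proof.
move=> ag; rewrite /g (pt_local pf ag) (pt_local pe ag).
by elim: (f s') => //= a w ->; apply: closed_local ag.
Qed.

(** All w no longer than f s are covered, since every intermediate value of the loop must be bounded
    too. *)
Let growth : exists2 D, polyfun D & forall s w,
  size w <= size (f s) -> size (prec (fun a => h a s) (e s) w) <= D (tot m s).
Proof.
have [D pD hD] := fin_all_exists2 hadd.
have [F pF hF] := pt_size pf; have [E pE hE] := pt_size pe.
pose D' n := \sum_a D a n; have pD' : polyfun D' by exact: polyfun_sum.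
exists (fun n => E n + F n * D' (n + F n)).
  by polyfun; apply: (polyfun_comp pD'); polyfun.
move=> s w le_w; have le_wF := leq_trans le_w (hF s).
have := @size_prec (fun a => h a s) (e s) w (fun n => D' (tot m s + n)).
move=> /(_ _ _)/leq_trans; apply.
- by move=> i j le_ij; apply: (polyfun_mono pD'); rewrite leq_add2l.
- move=> a v c; apply: leq_trans (hD a s v c) _; rewrite leq_add2l.
  by rewrite /D' (bigD1 a) //= leq_addr.
- rewrite leq_add ?hE // leq_mul //; apply: (polyfun_mono pD').
  by rewrite leq_add2l.
Qed.

(** Recursion becomes a loop: the word is reversed onto a stack and popped from its last letter on,
    while the processed suffix and the current value are kept on two other stacks. *)
Let prog_at k : m <= k -> exists p, exists2 B, polyfun B &
  forall s, clean k s -> within p s (upd s k (g s)) (B (tot k s)).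
Proof.
move=> le_mk.
have [D pD hD] := growth.
have [F pF hF] := pt_size pf.
have [qf [Tf pTf hqf]] := pt_prog pf le_mk.
have [|qe [Te pTe hqe]] := pt_prog pe (k := k.+2); first by lia.
have pv x : x < k.+3 -> polytime k.+3 (fun s => s x) by exact: polytime_var.
have Hh a : exists qT : prog * (nat -> nat), polyfun qT.2 /\
    forall s, clean k.+3 s -> within qT.1 s
      (upd s k.+3 (h a s (s k) (s k.+2))) (qT.2 (tot k.+3 s)).
  have le_mk3 : m <= k.+3 by lia.
  have lt1 : k < k.+3 by lia.
  have lt2 : k.+2 < k.+3 by lia.
  have [q [T pT hT]] :=
    pt_prog (hcl a le_mk3 (pv _ lt1) (pv _ lt2)) (leqnn _).
  by exists (q, T).
have {pv Hh} [qT] := fin_all_exists Hh.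
move=> /all_and2 [pT hT].
pose body a := Seq (qT a).1 (Seq (clear k.+2)
  (Seq (transfer k.+3 k.+4 k.+2) (Push k a))).
pose T n := \sum_a (qT a).2 n; have pT' : polyfun T by exact: polyfun_sum.
(* Stack k holds the processed suffix, k + 1 the remaining letters in reverse, k + 2 the current
   value. The step leaves its result on k + 3, and k + 4 serves the transfer. *)
pose st s w v c := upd (upd (upd s k w) k.+1 v) k.+2 c.
(* Per letter: 1 for the pop, T for the step, 2D + 1 for [clear], 6D + 2 for [transfer], 2 for the
   push. *)
pose C n := T (n + F n + D n) + 8 * D n + 6.
(* Induction on v for all w: passing a letter from v to w leaves [catrev v w] unchanged. *)
have loop s v : clean k s -> forall w,
    size (catrev v w) <= size (f s) ->
    let r := prec (fun a => h a s) (e s) in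
    within (Loop k.+1 body) (st s w v (r w)) (st s (catrev v w) [::]
      (r (catrev v w))) (size v * C (tot k s) + 1).
  move=> cl; elim: v => [|a v IH] w /= le_w.
    by exists 1 => //; apply: RLoop0; rewrite /st; store_at.
  set r := prec _ _; set c := r w; set n := tot k s.
  have le_D u : size u <= size (f s) -> size (r u) <= D n.
    by move/hD/leq_trans; apply; apply: polyfun_mono pD _ _ (leq_tot s le_mk).
  have le_F : size (f s) <= F n.
    by apply: leq_trans (hF s) (polyfun_mono pF (leq_tot s le_mk)).
  have Ec : h a s w c = r (a :: w) by [].
  have size_st := le_w; rewrite catrevE size_cat size_rev /= in size_st.
  have le_c : size c <= D n by apply: le_D; lia.
  have le_c' : size (r (a :: w)) <= D n by apply: le_D => /=; lia.
  have cl0 : clean k.+3 (st s w v c).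
    by move=> x le_x; rewrite -(cl x _); [rewrite /st; store_at | lia].
  have tot0 : tot k.+3 (st s w v c) <= n + F n + D n.
    by rewrite /st !tot_upd; lia.
  have h1 := hT a _ cl0.
  have stk : st s w v c k = w by rewrite /st; store_at.
  have stk2 : st s w v c k.+2 = c by rewrite /st; store_at.
  have ag : agree m (st s w v c) s by move=> x lt_x; rewrite /st; store_at.
  rewrite stk stk2 (closed_local w c (hcl a) ag) Ec in h1.
  set s1 := upd _ _ _ in h1.
  have h2 : within (clear k.+2) s1 (upd s1 k.+2 [::]) (2 * size c + 1).
    by apply: within_clear; rewrite /s1 /st; store_at.
  set s2 := upd s1 _ _ in h2.
  have h3 : within (transfer k.+3 k.+4 k.+2) s2
      (upd (upd s2 k.+3 [::]) k.+2 (r (a :: w))) (6 * size (r (a :: w)) + 2).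
    apply: within_transfer; rewrite ?/s2 ?/s1 ?/st; try lia; try by store_at.
    by rewrite -(cl k.+4); [store_at | lia].
  set s3 := upd (upd s2 _ _) _ _ in h3.
  have h4 := within_push k a s3.
  have Es4 : upd s3 k (a :: s3 k) = st s (a :: w) v (r (a :: w)).
    rewrite (_ : s3 k = w); last by rewrite /s3 /s2 /s1 /st; store_at.
    rewrite /s3 /s2 /s1 /st; apply: functional_extensionality => x; rewrite /upd.
    have := cl x.
    by repeat case: (@eqP nat) => ?; subst=> //; move=> H; try lia;
    rewrite H //; lia.
  rewrite Es4 in h4.
  have h5 := within_seq h1 (within_seq h2 (within_seq h3 h4)).
  have h6 := IH (a :: w) le_w.
  apply: within_conv (within_loop (w := v) _ _ h6) (erefl _) _.
  - by rewrite /st; store_at.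
  - rewrite (_ : upd _ _ _ = st s w v c); first exact: h5.
    rewrite /st; store_eq.
  - have : (qT a).2 (tot k.+3 (st s w v c)) <= T (n + F n + D n).
      apply: leq_trans (polyfun_mono (pT a) tot0) _.
      by rewrite /T (bigD1 a) //= leq_addr.
    rewrite -/n /C; lia.
(* [move] reverses f s onto k + 1 and leaves k empty, which is the processed suffix at the start. *)
exists (Seq qf (Seq (move k k.+1) (Seq qe (Seq (Loop k.+1 body)
  (Seq (clear k) (transfer k.+2 k.+1 k)))))).
exists (fun n => Tf n + (3 * F n + 1 + (Te (n + F n) + (F n * C n + 1 +
  (2 * F n + 1 + (6 * D n + 2)))))).
  by polyfun; apply: (polyfun_comp pTe); polyfun.
move=> s cl; set n := tot k s.
have le_F : size (f s) <= F n.
  by apply: leq_trans (hF s) (polyfun_mono pF (leq_tot s le_mk)).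
have le_D : size (g s) <= D n.
  apply: leq_trans (hD s (f s) (leqnn _)) _.
  exact: polyfun_mono pD _ _ (leq_tot s le_mk).
have h1 := hqf s cl; set s1 := upd _ _ _ in h1.
have s1k : s1 k = f s by rewrite /s1; store_at.
have h2 : within (move k k.+1) s1 (upd (upd s k [::]) k.+1 (rev (f s)))
    (3 * size (f s) + 1).
  have /within_move/(_ s1k) w2 : k != k.+1 by lia.
  apply: within_conv w2 _ (leqnn _).
  rewrite (_ : s1 k.+1 = [::]); last by rewrite -(cl k.+1) /s1 //; store_at.
  rewrite /s1; store_eq.
set s2 := upd _ k.+1 _ in h2.
have ag2 : agree m s2 s by move=> x lt_x; rewrite /s2; store_at.
have cl2 : clean k.+2 s2.
  by move=> x le_x; rewrite -(cl x _); [rewrite /s2; store_at | lia].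
have h3 := hqe s2 cl2; rewrite (pt_local pe ag2) in h3.
have tot2 : tot k.+2 s2 = n + size (f s).
  by rewrite /s2 !tot_upd addn0 size_rev.
have h4 := loop s (rev (f s)) cl [::]; rewrite catrevE revK cats0 size_rev in h4.
have {}h4 := h4 (leqnn _); rewrite /= -/(g s) in h4.
have h5 : within (clear k) (st s (f s) [::] (g s)) (st s [::] [::] (g s))
    (2 * size (f s) + 1).
  apply: within_conv (within_clear _) _ (leqnn _).
    by rewrite /st; store_at.
  rewrite /st; store_eq.
have h6 : within (transfer k.+2 k.+1 k) (st s [::] [::] (g s))
    (upd s k (g s)) (6 * size (g s) + 2).
  apply: within_conv (within_transfer _ _ _ _ _ _) _ (leqnn _);
    rewrite ?/st; try lia; try by store_at.
  apply: functional_extensionality => x; rewrite /upd.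
  have := cl x.
  by repeat case: (@eqP nat) => ?; subst=> //; move=> H; try lia;
    rewrite H //; lia.
apply: within_conv (within_seq h1 (within_seq h2 (within_seq h3
  (within_seq h4 (within_seq h5 h6))))) (erefl _) _.
have := polyfun_mono pTe (_ : tot k.+2 s2 <= n + F n).
rewrite tot2 leq_add2l => /(_ le_F).
have : size (f s) * C n <= F n * C n by rewrite leq_mul2r le_F orbT.
rewrite -/n; lia.
Qed.

Lemma polytime_prec :
  polytime m (fun s => prec (fun a => h a s) (e s) (f s)).
Proof.
split; [exact: g_local | | exact: prog_at].
have [D pD hD] := growth; exists D => // s; exact: hD.
Qed.
End Prec.

(** * Closure properties and elementary tests *)

Lemma additive_le b m h :
  (forall s w c, size (h s w c) <= size c + size w + b) -> additive m h.
Proof.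
move=> hb; exists (fun n => n + b) => [|s w c]; first by polyfun.
by apply: leq_trans (hb s w c) _; lia.
Qed.

(** The increment is at most the size of a polynomial time word: placing w on the spare stack m
    makes [pt_size] applicable. *)
Lemma additive_closed1 m h (u : store -> word -> word) :
  (forall k f, m <= k -> polytime k f -> polytime k (fun s => u s (f s))) ->
  (forall s w c, size (h s w c) <= size c + size (u s w)) -> additive m h.
Proof.
move=> pu hu; have pv := polytime_var (ltnSn m).
have [D pD hD] := pt_size (pu m.+1 _ (leqnSn m) pv).
exists D => // s w c; apply: leq_trans (hu s w c) _; rewrite leq_add2l.
have := hD (upd s m w); rewrite tot_upd /(upd _ _ _ _) eqxx.
rewrite (_ : u (upd s m w) w = u s w) //.
apply: (pt_local (pu m (fun=> w) (leqnn m) (polytime_const _ _))).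
exact: agree_upd.
Qed.

Lemma polytime_foldr m f e (h : letter -> store -> word -> word) :
  polytime m f -> polytime m e ->
  (forall a k g, m <= k -> polytime k g -> polytime k (fun s => h a s (g s))) ->
  (forall a, additive m (fun s w c => h a s c)) ->
  polytime m (fun s => foldr (fun a => h a s) (e s) (f s)).
Proof.
move=> pf pe hcl hadd.
apply: polytime_ext (polytime_prec pf pe (h := fun a s w c => h a s c) _ hadd).
  by move=> s; elim: (f s) => //= a w ->.
by move=> a k g1 g2 le_mk _; apply: hcl.
Qed.

(** A recursion whose step ignores the recursive value, so that growth is no obstacle. *)
Lemma polytime_case m f g (h : letter -> store -> word -> word) :
  polytime m f -> polytime m g ->
  (forall a k r, m <= k -> polytime k r -> polytime k (fun s => h a s (r s))) ->
  polytime m (fun s => if f s is a :: w then h a s w else g s).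
Proof.
move=> pf pg hcl.
apply: polytime_ext (polytime_prec pf pg (h := fun a s w c => h a s w) _ _).
- by move=> s; case: (f s).
- by move=> a k g1 g2 le_mk p1 _; apply: hcl.
by move=> a; apply: (additive_closed1 (hcl a)) => s w c; apply: leq_addl.
Qed.

Definition decidable_in m (t : store -> bool) :=
  polytime m (fun s => if t s then [:: Comma] else [::]).

Lemma decidable_nonnil m f : polytime m f ->
  decidable_in m (fun s => ~~ nilp (f s)).
Proof.
move=> pf; apply: polytime_ext (polytime_case (h := fun _ _ _ => [:: Comma])
  pf (polytime_nil m) _); first by move=> s; case: (f s).
by move=> *; apply: polytime_const.
Qed.

Lemma polytime_if m t f g : decidable_in m t -> polytime m f -> polytime m g ->
  polytime m (fun s => if t s then f s else g s).
Proof.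
move=> pt pf pg; apply: polytime_ext (polytime_case (h := fun _ s _ => f s)
  pt pg _); first by move=> s; case: (t s).
by move=> a k r le_mk _; apply: polytime_weak pf.
Qed.

Lemma decidable_and m t u : decidable_in m t -> decidable_in m u ->
  decidable_in m (fun s => t s && u s).
Proof.
move=> pt pu; apply: polytime_ext (polytime_if pt pu (polytime_nil m)).
by move=> s; case: (t s).
Qed.

Lemma decidable_neg m t : decidable_in m t -> decidable_in m (fun s => ~~ t s).
Proof.
move=> pt.
apply: polytime_ext
  (polytime_if pt (polytime_nil m) (polytime_const m [:: Comma])).
by move=> s; case: (t s).
Qed.

Lemma polytime_cat m f g : polytime m f -> polytime m g ->
  polytime m (fun s => f s ++ g s).
Proof.
move=> pf pg; apply: polytime_ext (polytime_foldr (h := fun a _ c => a :: c)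
  pf pg _ _); first by move=> s; elim: (f s) => //= a w ->.
  by move=> a k r _; apply: polytime_cons.
by move=> a; apply: (@additive_le 1) => s w c /=; lia.
Qed.

Lemma polytime_rev m f : polytime m f -> polytime m (fun s => rev (f s)).
Proof.
move=> pf; apply: polytime_ext (polytime_foldr (h := fun a _ c => c ++ [:: a])
  pf (polytime_nil m) _ _).
- by move=> s; elim: (f s) => //= a w ->; rewrite rev_cons cats1.
- by move=> a k r _ pr; apply: polytime_cat pr (polytime_const _ _).
by move=> a; apply: (@additive_le 1) => s w c; rewrite size_cat /=; lia.
Qed.

Lemma polytime_filter m (p : pred letter) f :
  polytime m f -> polytime m (fun s => filter p (f s)).
Proof.
move=> pf; apply: polytime_ext (polytime_foldr
  (h := fun a _ c => if p a then a :: c else c) pf (polytime_nil m) _ _).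
- by [].
- by move=> a k r _ pr; case: (p a) => //; apply: polytime_cons.
by move=> a; apply: (@additive_le 1) => s w c; case: (p a) => /=; lia.
Qed.

(* The first letter of v is a marker: a mismatch is recorded as [::]. *)
Definition strip (a : letter) (v : word) : word :=
  if v is c :: v' then
    (if v' is b :: v'' then if a == b then c :: v'' else [::] else [::])
  else [::].

(** The empty word is absorbing for [strip], so a mismatch is never mistaken for success; the marker
    alone remains when both words run out together. *)
Lemma foldl_strip c u v :
  (foldl (fun x a => strip a x) (c :: v) u == [:: c]) = (u == v).
Proof.
elim: u v => [|a u IH] [|b v] /=; rewrite ?eqseq_cons ?eqxx //=.
- by elim: u {IH}.
- by case: (a =P b) => _ /=; [rewrite IH | elim: u {IH}].
Qed.

Lemma decidable_eq m f g : polytime m f -> polytime m g ->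
  decidable_in m (fun s => f s == g s).
Proof.
move=> pf pg.
(* [foldr] starts at the last letter, so reversing f s lets g s be stripped from the front. *)
pose r s := foldr (fun a => strip a) (Comma :: g s) (rev (f s)).
have pr : polytime m r.
  apply: (polytime_foldr (h := fun a _ => strip a)) => [|||a].
  - exact: polytime_rev.
  - exact: polytime_cons.
  - move=> a k x _ px.
    apply: (polytime_case (h := fun c s v' =>
      if v' is b :: v'' then if a == b then c :: v'' else [::] else [::])).
    + exact: px.
    + exact: polytime_nil.
    move=> c j y _ py; apply: (polytime_case (h := fun b s v'' =>
      if a == b then c :: v'' else [::])) => //; first exact: polytime_nil.
    move=> b i z _ pz; case: (a == b); last exact: polytime_nil.
    exact: polytime_cons.
  - apply: (@additive_le 0) => s w [|c [|b v]] //=.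
    by case: (a == b) => /=; lia.
apply: polytime_ext (polytime_case (h := fun c _ v =>
  if (c == Comma) && nilp v then [:: Comma] else [::]) pr (polytime_nil m) _);
  last first.
  move=> c k x _ px; case: (c == Comma); last exact: polytime_nil.
  apply: polytime_if; [|exact: polytime_const..].
  apply: polytime_ext (decidable_neg (decidable_nonnil px)) => s.
  by rewrite negbK.
move=> s; rewrite -(foldl_strip Comma) /r -[X in foldl _ _ X]revK foldl_rev.
case: (foldr _ _ _) => [|c [|d v]] //=; rewrite ?eqseq_cons ?andbF //.
Qed.

(** * Words divided into blocks by a separator *)

Fixpoint before (sep : letter) (w : word) : word :=
  if w is a :: w' then if a == sep then [::] else a :: before sep w' else [::].

Fixpoint after (sep : letter) (w : word) : word :=
  if w is a :: w' then if a == sep then w' else after sep w' else [::].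

Lemma size_before sep w : size (before sep w) <= size w.
Proof. by elim: w => //= a w IH; case: ifP. Qed.

Lemma polytime_before m sep f :
  polytime m f -> polytime m (fun s => before sep (f s)).
Proof.
move=> pf; apply: polytime_ext (polytime_foldr
  (h := fun a _ c => if a == sep then [::] else a :: c) pf (polytime_nil m) _ _).
- by move=> s; elim: (f s) => //= a w ->.
- move=> a k r _ pr; case: (a == sep); first exact: polytime_nil.
  exact: polytime_cons.
by move=> a; apply: (@additive_le 1) => s w c; case: eqP => /=; lia.
Qed.

Lemma polytime_after m sep f :
  polytime m f -> polytime m (fun s => after sep (f s)).
Proof.
move=> pf; apply: polytime_ext (polytime_prec
  (h := fun a _ w c => if a == sep then w else c) pf (polytime_nil m) _ _).
- by move=> s; elim: (f s) => //= a w ->.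
- by move=> a k r1 r2 _ p1 p2; case: (a == sep).
by move=> a; apply: (@additive_le 0) => s w c; case: eqP => /=; lia.
Qed.

(* Folds over the suffixes of text = w1 sep w2 sep ... wn sep that start with
   a block.  A block is visited at the separator in front of it, hence the
   additional sep. *)
Definition foldsuf T sep (h : word -> T -> T) e text :=
  prec (fun a w c => if (a == sep) && ~~ nilp w then h w c else c)
    e (sep :: text).

Definition foldblk T sep (h : word -> T -> T) :=
  foldsuf sep (fun w => h (before sep w)).

Lemma polytime_foldsuf m sep f e h :
  polytime m f -> polytime m e -> closed_op m h -> additive m h ->
  polytime m (fun s => foldsuf sep (h s) (e s) (f s)).
Proof.
move=> pf pe hcl [D pD hD]; apply: (@polytime_prec m _ _ (fun a s w c =>
    if (a == sep) && ~~ nilp w then h s w c else c)) => //.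
- exact: polytime_cons.
- move=> a k r1 r2 le_mk p1 p2; case: (a == sep) => //=.
  by apply: polytime_if => //; [exact: decidable_nonnil | exact: hcl].
by move=> a; exists D => // s w c; case: ifP => _; last exact: leq_addr.
Qed.

Lemma polytime_foldblk m sep f e h :
  polytime m f -> polytime m e -> closed_op m h -> additive m h ->
  polytime m (fun s => foldblk sep (h s) (e s) (f s)).
Proof.
move=> pf pe hcl [D pD hD].
apply: (@polytime_foldsuf m sep _ _ (fun s w => h s (before sep w))) => //.
  by move=> k r1 r2 le_mk p1 p2; apply: hcl => //; apply: polytime_before.
exists D => // s w c; apply: leq_trans (hD _ _ _) _; rewrite leq_add2l.
by apply: (polyfun_mono pD); rewrite leq_add2l size_before.
Qed.

Definition blocks sep (ws : seq word) : word :=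
  flatten [seq rcons w sep | w <- ws].

Lemma blocks_cons sep w ws : blocks sep (w :: ws) = w ++ sep :: blocks sep ws.
Proof. by rewrite /blocks /= -cats1 -catA. Qed.

Lemma blocks_cat sep ws vs :
  blocks sep (ws ++ vs) = blocks sep ws ++ blocks sep vs.
Proof. by rewrite /blocks map_cat flatten_cat. Qed.

Lemma before_cat sep w v : sep \notin w -> before sep (w ++ sep :: v) = w.
Proof.
elim: w => [|a w IH] /=; first by rewrite eqxx.
by rewrite inE negb_or eq_sym => /andP[/negbTE -> /IH ->].
Qed.

Lemma after_cat sep w v : sep \notin w -> after sep (w ++ sep :: v) = v.
Proof.
elim: w => [|a w IH] /=; first by rewrite eqxx.
by rewrite inE negb_or eq_sym => /andP[/negbTE -> /IH ->].
Qed.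

Lemma foldsuf_cons T sep (h : word -> T -> T) e w ws : sep \notin w ->
  foldsuf sep h e (blocks sep (w :: ws)) =
  h (blocks sep (w :: ws)) (foldsuf sep h e (blocks sep ws)).
Proof.
rewrite blocks_cons /foldsuf; set k := (X in prec X) => sep_w.
rewrite {1}/prec -/(prec k e) {1}/k eqxx.
(* The guard only skips a separator with nothing behind it; here a block and its separator
   follow. *)
have -> : nilp (w ++ sep :: blocks sep ws) = false by case: w {sep_w}.
congr (h _ _); elim: w sep_w => //= a w IH.
by rewrite inE negb_or eq_sym => /andP[/negbTE ne /IH <-]; rewrite {1}/k ne.
Qed.

Lemma foldblk_blocks T sep (h : word -> T -> T) e ws :
  all (fun w => sep \notin w) ws ->
  foldblk sep h e (blocks sep ws) = foldr h e ws.
Proof.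
rewrite /foldblk; elim: ws => [|w ws IH] /=; first by rewrite /foldsuf /= andbF.
move=> /andP[sep_w /IH {}IH].
by rewrite foldsuf_cons // IH blocks_cons before_cat.
Qed.

(** Folding [cons] over the blocks recovers the list. *)
Lemma blocks_inj sep ws vs : all (fun w => sep \notin w) ws ->
  all (fun w => sep \notin w) vs -> blocks sep ws = blocks sep vs -> ws = vs.
Proof.
have fk us : foldr cons [::] us = us :> seq word by elim: us => //= u us ->.
move=> hw hv /(congr1 (foldblk sep cons [::])).
by rewrite !foldblk_blocks // !fk.
Qed.

(** * Binary numbers *)

Definition bits := all (fun a => if a is Bit _ then true else false).

Lemma bits_binary m : bits (binary m).
Proof. by rewrite /binary; elim: (rev _). Qed.

Lemma binary_rec m : 1 < m -> binary m = rcons (binary m./2) (Bit (odd m)).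
Proof.
move=> m_gt1; rewrite /binary trunc_log2S //.
have iotaE k : iota 0 k.+1 = 0 :: map succn (iota 0 k).
  by rewrite /= -(iotaDl 1).
rewrite iotaE rev_cons map_rcons divn1; congr rcons.
rewrite -map_rev -map_comp; apply: eq_map => i /=.
by rewrite expnS divnMA divn2.
Qed.

Definition decode (w : word) := foldl (fun n a => n.*2 + (a == Bit true)) 0 w.

Lemma binaryK m : 0 < m -> decode (binary m) = m.
Proof.
elim/ltn_ind: m => m IH m_gt0; have [m_gt1|] := ltnP 1 m; last first.
  by case: m m_gt0 {IH} => [|[|]].
rewrite binary_rec // /decode -cats1 foldl_cat /= -/(decode _) IH; try lia.
by rewrite -[in RHS](odd_double_half m) addnC; case: (odd m).
Qed.

Lemma binary_inj m n : 0 < m -> 0 < n -> binary m = binary n -> m = n.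
Proof. by move=> m_gt0 n_gt0 /(congr1 decode); rewrite !binaryK. Qed.

(* The first letter of v is the carry. *)
Definition add_bit (a : letter) (v : word) : word :=
  if v is b :: v' then
    if a == Bit true then
      if b == Bit true then [:: Bit true, Bit false & v']
      else [:: Bit false, Bit true & v']
    else [:: Bit false, b & v']
  else [::].

(** A carry left at the front becomes a new leading digit. In particular the empty word goes to
    [binary 1], so counting can start from it. *)
Definition incr (w : word) : word :=
  if foldr add_bit [:: Bit true] w is a :: v then
    if a == Bit true then a :: v else v
  else [::].

(** Letters behind the carry stay untouched, so low digits already computed can be split off. *)
Lemma foldr_add_bit b v w :
  exists b' v', foldr add_bit (b :: v) w = b' :: v' ++ v /\
                foldr add_bit [:: b] w = b' :: v'.
Proof.
elim: w => [|a w [b' [v' [IH1 IH2]]]] /=; first by exists b, [::].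
rewrite IH1 IH2 /=; do 2?[case: eqP => _]; do 2 eexists; split; eauto; by [].
Qed.

Lemma incr_rcons0 w : bits w -> incr (rcons w (Bit false)) = rcons w (Bit true).
Proof.
move=> bw; rewrite /incr foldr_rcons /=.
suff -> : foldr add_bit [:: Bit false; Bit true] w =
    Bit false :: rcons w (Bit true).
  by [].
by elim: w bw => //= -[[]| |] w IH //= /IH ->.
Qed.

Lemma incr_rcons1 w : incr (rcons w (Bit true)) = rcons (incr w) (Bit false).
Proof.
rewrite /incr foldr_rcons /=.
have [b [v [-> ->]]] := foldr_add_bit (Bit true) [:: Bit false] w.
by case: eqP => _; rewrite ?cats1.
Qed.

(** Induction on halves: a last digit 0 becomes 1, and a last digit 1 becomes 0 and passes the carry
    to the half. *)
Lemma incr_binary m : 0 < m -> incr (binary m) = binary m.+1.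
Proof.
elim/ltn_ind: m => m IH m_gt0; have [m_gt1|] := ltnP 1 m; last first.
  by case: m m_gt0 {IH} => [|[|]].
rewrite binary_rec // [in RHS]binary_rec; last by lia.
rewrite /= uphalf_half; case: (boolP (odd m)) => _.
  by rewrite incr_rcons1 IH //; lia.
by rewrite incr_rcons0 ?bits_binary.
Qed.

Lemma size_incr w : size (incr w) <= size w + 1.
Proof.
rewrite /incr; have: size (foldr add_bit [:: Bit true] w) <= size w + 1.
  elim: w => //= a w; case: (foldr _ _ _) => [|b v] //=.
  by do 2?[case: eqP => _] => /=; lia.
by case: (foldr _ _ _) => [|b v] //=; case: eqP => _ /=; lia.
Qed.

Lemma polytime_incr m f : polytime m f -> polytime m (fun s => incr (f s)).
Proof.
move=> pf; apply: (@polytime_case m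
    (fun s => foldr add_bit [:: Bit true] (f s)) _
    (fun a _ v => if a == Bit true then a :: v else v)).
- apply: (@polytime_foldr m _ (fun=> [:: Bit true])
    (fun a _ => add_bit a)) => //.
  + exact: polytime_const.
  + move=> a k g _ pg; apply: (@polytime_case k g _ (fun b _ v' =>
      if a == Bit true then
        if b == Bit true then [:: Bit true, Bit false & v']
        else [:: Bit false, Bit true & v']
      else [:: Bit false, b & v'])) => //; first exact: polytime_nil.
    by move=> b j r _ pr; do 2?case: eqP => _; do 2 apply: polytime_cons.
  + move=> a; apply: (@additive_le 1) => s w [|b v] //=.
    by do 2?case: eqP => _ /=; lia.
- exact: polytime_nil.
- by move=> a k r _ pr; case: eqP => _ //; apply: polytime_cons.
Qed.

(* The number of blocks in binary, except that 0 is the empty word. *)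
Definition count_blocks (u : word) := foldblk Comma (fun _ c => incr c) [::] u.

Lemma polytime_count_blocks m f :
  polytime m f -> polytime m (fun s => count_blocks (f s)).
Proof.
move=> pf; apply: (@polytime_foldblk m Comma f _ (fun s _ c => incr c)) => //.
- exact: polytime_nil.
- by move=> k f1 f2 _ _; apply: polytime_incr.
by apply: (@additive_le 1) => s w c; have := size_incr c; lia.
Qed.

Lemma count_blocksE w ws : all (fun w => Comma \notin w) (w :: ws) ->
  count_blocks (blocks Comma (w :: ws)) = binary (size ws).+1.
Proof.
move=> h; rewrite /count_blocks foldblk_blocks // {h} /=.
elim: ws => //= _ ws ->; exact: incr_binary.
Qed.

(** * The algorithm on words *)

Definition mem_blk sep (r text : word) :=
  ~~ nilp (foldblk sep (fun w c => if w == r then [:: Comma] else c) [::] text).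

Lemma mem_blkE sep r ws : all (fun w => sep \notin w) ws ->
  mem_blk sep r (blocks sep ws) = (r \in ws).
Proof.
move=> h; rewrite /mem_blk foldblk_blocks // {h}.
by elim: ws => //= w ws IH; rewrite inE eq_sym; case: eqP.
Qed.

Lemma decidable_mem_blk m sep f g : polytime m f -> polytime m g ->
  decidable_in m (fun s => mem_blk sep (f s) (g s)).
Proof.
move=> pf pg; apply: decidable_nonnil.
apply: (@polytime_foldblk m sep g _
  (fun s w c => if w == f s then [:: Comma] else c)) => //.
- exact: polytime_nil.
- move=> k f1 f2 le_mk p1 p2; apply: polytime_if => //.
    by apply: decidable_eq => //; apply: polytime_weak pf.
  exact: polytime_const.
by apply: (@additive_le 1) => s w c; case: ifP => _ /=; lia.
Qed.

(** In the reversed table, the suffix that starts with the value of point i has exactly i blocks;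
    this is how a record finds its number. *)
Definition rev_blk w := foldblk Comma (fun v c => c ++ v ++ [:: Comma]) [::] w.

Lemma rev_blkE ws : all (fun w => Comma \notin w) ws ->
  rev_blk (blocks Comma ws) = blocks Comma (rev ws).
Proof.
move=> h; rewrite /rev_blk foldblk_blocks // {h}.
elim: ws => //= w ws ->.
by rewrite rev_cons -cats1 blocks_cat blocks_cons.
Qed.

Lemma polytime_rev_blk m f : polytime m f -> polytime m (fun s => rev_blk (f s)).
Proof.
move=> pf; apply: (@polytime_foldblk m Comma f _
  (fun s v c => c ++ v ++ [:: Comma])) => //.
- exact: polytime_nil.
- move=> k f1 f2 _ p1 p2.
  by do 2?apply: polytime_cat => //; exact: polytime_const.
by apply: (@additive_le 1) => s w c; rewrite !size_cat /=; lia.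
Qed.

(* Turns v1,...,vn, into n;vn,...,1;v1, where the number of each record is
   counted afresh: a step that increments the number in the previous record
   would not be additive. *)
Definition records w :=
  foldsuf Comma (fun u c =>
    count_blocks u ++ Semicolon :: before Comma u ++ Comma :: c) [::] (rev_blk w).

Lemma polytime_records m f : polytime m f -> polytime m (fun s => records (f s)).
Proof.
move=> pf; apply: (@polytime_foldsuf m Comma _ _ (fun s u c =>
    count_blocks u ++ Semicolon :: before Comma u ++ Comma :: c)).
- exact: polytime_rev_blk.
- exact: polytime_nil.
- move=> k f1 f2 _ p1 p2.
  apply: polytime_cat; first exact: polytime_count_blocks.
  apply: polytime_cons; apply: polytime_cat; first exact: polytime_before.
  exact: polytime_cons.
apply: (@additive_closed1 m _ (fun _ u =>
    count_blocks u ++ Semicolon :: before Comma u ++ [:: Comma])).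
  move=> k g _ pg; apply: polytime_cat; first exact: polytime_count_blocks.
  apply: polytime_cons; apply: polytime_cat; first exact: polytime_before.
  exact: polytime_const.
by move=> s w c; do 2!rewrite !size_cat /=; lia.
Qed.

(* The fallback q does not matter once [fixes] has succeeded. *)
Definition lookup V E q v :=
  foldblk Comma (fun rc c =>
    if (after Semicolon rc == v) && mem_blk Comma (before Semicolon rc) V
    then before Semicolon rc else c) q E.

Lemma polytime_lookup m V E q v :
  polytime m V -> polytime m E -> polytime m q -> polytime m v ->
  polytime m (fun s => lookup (V s) (E s) (q s) (v s)).
Proof.
move=> pV pE pq pv; apply: (@polytime_foldblk m Comma E q (fun s rc c =>
    if (after Semicolon rc == v s) && mem_blk Comma (before Semicolon rc) (V s)
    then before Semicolon rc else c)) => //.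
- move=> k f1 f2 le_mk p1 p2.
  apply: polytime_if => //; last exact: polytime_before.
  apply: decidable_and.
    apply: decidable_eq; [exact: polytime_after | exact: polytime_weak pv].
  apply: decidable_mem_blk; [exact: polytime_before | exact: polytime_weak pV].
apply: (@additive_le 0) => s w c; case: ifP => _; last by lia.
by have := size_before Semicolon w; lia.
Qed.

(** Records come in decreasing order and the fold starts at the last of them, so appending puts the
    values in increasing order. *)
Definition table V E :=
  foldblk Comma (fun rc c =>
    c ++ lookup V E (before Semicolon rc) (after Semicolon rc) ++ [:: Comma])
    [::] E.

Lemma polytime_table m V E : polytime m V -> polytime m E ->
  polytime m (fun s => table (V s) (E s)).
Proof.
move=> pV pE.
have plookup k f : m <= k -> polytime k f -> polytime k (fun s =>
    lookup (V s) (E s) (before Semicolon (f s)) (after Semicolon (f s)) ++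
    [:: Comma]).
  move=> le_mk pf; apply: polytime_cat; last exact: polytime_const.
  apply: polytime_lookup; try exact: polytime_weak le_mk _.
    exact: polytime_before.
  exact: polytime_after.
apply: (@polytime_foldblk m Comma E _ (fun s rc c => c ++
    lookup (V s) (E s) (before Semicolon rc) (after Semicolon rc) ++
    [:: Comma])) => //.
- exact: polytime_nil.
- move=> k f1 f2 le_mk p1 p2; apply: polytime_cat => //; exact: plookup.
- apply: (@additive_closed1 m _ (fun s rc =>
    lookup (V s) (E s) (before Semicolon rc) (after Semicolon rc) ++
    [:: Comma])) => //.
  by move=> s w c; rewrite size_cat.
Qed.

(** One violation empties the accumulator, and nothing refills it. On encoded data the condition
    amounts to injectivity on the union of the images, by [fixes_setP]. *)
Definition fixes V E :=
  ~~ nilp (foldblk Comma (fun rc c =>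
    if mem_blk Comma (before Semicolon rc) V &&
       (lookup V E (before Semicolon rc) (after Semicolon rc)
          != before Semicolon rc)
    then [::] else c) [:: Comma] E).

Lemma decidable_fixes m V E : polytime m V -> polytime m E ->
  decidable_in m (fun s => fixes (V s) (E s)).
Proof.
move=> pV pE; apply: decidable_nonnil.
apply: (@polytime_foldblk m Comma E _ (fun s rc c =>
    if mem_blk Comma (before Semicolon rc) (V s) &&
       (lookup (V s) (E s) (before Semicolon rc) (after Semicolon rc)
          != before Semicolon rc)
    then [::] else c)) => //.
- exact: polytime_const.
- move=> k f1 f2 le_mk p1 p2.
  apply: polytime_if => //; last exact: polytime_nil.
  have pb : polytime k (fun s => before Semicolon (f1 s)) by exact: polytime_before.
  have pa : polytime k (fun s => after Semicolon (f1 s)) by exact: polytime_after.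
  apply: decidable_and.
    by apply: decidable_mem_blk => //; apply: polytime_weak pV.
  apply: decidable_neg; apply: decidable_eq => //; apply: polytime_lookup => //.
    exact: polytime_weak pV.
  exact: polytime_weak pE.
by apply: (@additive_le 0) => s w c; case: ifP => _ /=; lia.
Qed.

(** The accumulator is already in output format, so repetitions can be looked up in it directly. *)
Definition list_right_identities V T :=
  foldblk Semicolon (fun w c =>
    if fixes V (records w) && ~~ mem_blk Semicolon (table V (records w)) c
    then table V (records w) ++ Semicolon :: c else c) [::] T.

Lemma polytime_list_right_identities m V T : polytime m V -> polytime m T ->
  polytime m (fun s => list_right_identities (V s) (T s)).
Proof.
move=> pV pT.
have ptab k f : m <= k -> polytime k f ->
    polytime k (fun s => table (V s) (records (f s))).
  move=> le_mk pf; apply: polytime_table; first exact: polytime_weak pV.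
  exact: polytime_records.
apply: (@polytime_foldblk m Semicolon T _ (fun s w c =>
    if fixes (V s) (records w) &&
      ~~ mem_blk Semicolon (table (V s) (records w)) c
    then table (V s) (records w) ++ Semicolon :: c else c)) => //.
- exact: polytime_nil.
- move=> k f1 f2 le_mk p1 p2; have pt1 := ptab k f1 le_mk p1.
  apply: polytime_if => //.
    apply: decidable_and.
      apply: decidable_fixes; first exact: polytime_weak pV.
      exact: polytime_records.
    by apply: decidable_neg; apply: decidable_mem_blk.
  by apply: polytime_cat => //; apply: polytime_cons.
- apply: (@additive_closed1 m _
    (fun s w => Semicolon :: table (V s) (records w))).
    by move=> k f le_mk pf; apply: polytime_cons; apply: ptab.
  move=> s w c; case: ifP => _; last exact: leq_addr.
  by rewrite size_cat /=; lia.
Qed.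

(** The two calls of [after] skip [ngen] and [degree]. Deleting the semicolons of T fuses all tables
    into one list of points, the union of the images. *)
Definition solve (x : word) :=
  let T := after Semicolon (after Semicolon x) in
  list_right_identities (filter (predC1 Semicolon) T) T.

Lemma polytime_solve : polytime 1 (fun s => solve (s 0)).
Proof.
have pT : polytime 1 (fun s => after Semicolon (after Semicolon (s 0))).
  by do 2 apply: polytime_after; apply: polytime_var.
by apply: polytime_list_right_identities => //; apply: polytime_filter.
Qed.

(** * Correctness *)

Section Semantics.
Variable n : nat.
Implicit Types (s t : transf n) (gs : seq (transf n)) (I : {set 'I_n}).

Definition images gs : {set 'I_n} :=
  [set p | has (fun s : transf n => p \in codom s) gs].

(* If s permutes I, this is s followed by the inverse of s|_I. *)
Definition retract I s : transf n :=
  [ffun q => foldr (fun p c => if (s p == s q) && (p \in I) then p else c) q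
    (rev (enum 'I_n))].

Definition fixes_set I s := [forall q in I, retract I s q == q].

Definition right_identities gs :=
  let I := images gs in
  foldr (fun s l => if fixes_set I s && (retract I s \notin l)
                    then retract I s :: l else l) [::] gs.

Definition point (q : 'I_n) := binary q.+1.

Definition table_word s := blocks Comma [seq point (s q) | q <- enum 'I_n].

Lemma point_inj : injective point.
Proof. by move=> p q /binary_inj h; apply/val_inj/succn_inj/h. Qed.

Lemma comma_bits w : bits w -> Comma \notin w.
Proof. by move=> /allP h; apply/negP => /h. Qed.

Lemma semicolon_bits w : bits w -> Semicolon \notin w.
Proof. by move=> /allP h; apply/negP => /h. Qed.

Lemma comma_points (T : Type) (f : T -> 'I_n) l :
  all (fun w => Comma \notin w) [seq point (f q) | q <- l].
Proof. by elim: l => //= q l ->; rewrite comma_bits ?bits_binary. Qed.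

Lemma semicolon_table s : Semicolon \notin table_word s.
Proof.
rewrite /table_word; elim: (enum _) => //= q l IH.
by rewrite blocks_cons mem_cat inE negb_or semicolon_bits ?bits_binary.
Qed.

Lemma semicolon_tables gs :
  all (fun w => Semicolon \notin w) (map table_word gs).
Proof. by elim: gs => //= s gs ->; rewrite semicolon_table. Qed.

Lemma encode_tablesE gs :
  encode_tables gs = blocks Semicolon (map table_word gs).
Proof.
rewrite /encode_tables /blocks -map_comp; congr flatten; apply: eq_map => s /=.
by rewrite /encode_table /table_word /blocks -map_comp.
Qed.

Lemma table_word_inj : injective table_word.
Proof.
move=> s t /blocks_inj h; apply/ffunP => q.
have {h} /eq_in_map := h (comma_points _ _) (comma_points _ _).
by move=> /(_ q)/(_ _)/point_inj -> //; rewrite mem_enum.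
Qed.

Definition record s q : word := point q ++ Semicolon :: point (s q).

Lemma comma_record s l : all (fun w => Comma \notin w) (map (record s) l).
Proof.
elim: l => //= q l ->; rewrite /record mem_cat inE !negb_or.
by rewrite !comma_bits ?bits_binary.
Qed.

Lemma before_record s q : before Semicolon (record s q) = point q.
Proof. by rewrite before_cat // semicolon_bits ?bits_binary. Qed.

Lemma after_record s q : after Semicolon (record s q) = point (s q).
Proof. by rewrite after_cat // semicolon_bits ?bits_binary. Qed.

Lemma recordsE s :
  records (table_word s) = blocks Comma (map (record s) (rev (enum 'I_n))).
Proof.
rewrite /records rev_blkE ?comma_points // -map_rev.
(* This property passes to tails. It makes the value of the head the length of the tail, so the
   number of blocks from there on, in binary, is the [point] of the head. *)
have : map val (rev (enum 'I_n)) = rev (iota 0 (size (rev (enum 'I_n)))).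
  by rewrite map_rev val_enum_ord size_rev size_enum_ord.
elim: (rev _) => [|q l IH]; first by rewrite /foldsuf.
rewrite [size _]/= -addn1 iotaD rev_cat add0n => -[Eq El].
have := comma_points s (q :: l); rewrite [map _ (q :: l)]/= => hql.
rewrite foldsuf_cons; last by case/andP: hql.
rewrite IH // count_blocksE // size_map blocks_cons before_cat.
  by rewrite -Eq [map _ (_ :: _)]/= blocks_cons /record -catA.
by case/andP: hql.
Qed.

Definition image_word gs :=
  blocks Comma
    (flatten [seq [seq point (s q) | q <- enum 'I_n] | s : transf n <- gs]).

Lemma filter_tables gs :
  filter (predC1 Semicolon) (encode_tables gs) = image_word gs.
Proof.
rewrite encode_tablesE /image_word; elim: gs => //= s gs IH.
rewrite blocks_cons blocks_cat filter_cat /= IH; congr (_ ++ _).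
apply/all_filterP/allP => a /=; apply: contraTneq => ->.
exact: semicolon_table.
Qed.

Lemma mem_image_word gs p :
  mem_blk Comma (point p) (image_word gs) = (p \in images gs).
Proof.
rewrite mem_blkE; last first.
  by elim: gs => //= s gs IH; rewrite all_cat comma_points.
rewrite inE; apply/flatten_mapP/hasP => -[s s_gs].
  by case/mapP=> q _ /point_inj ->; exists s => //; apply: codom_f.
by case/codomP=> q ->; exists s => //; apply/map_f; rewrite mem_enum.
Qed.

(** Both sides are folds over [rev (enum 'I_n)], the order of the records, with the same choice at
    each point. *)
Lemma lookupE gs s q :
  lookup (image_word gs) (records (table_word s)) (point q) (point (s q)) =
  point (retract (images gs) s q).
Proof.
rewrite /lookup recordsE foldblk_blocks ?comma_record // ffunE.
elim: (rev _) => //= p l ->.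
rewrite before_record after_record mem_image_word (inj_eq point_inj).
by case: ifP.
Qed.

Lemma tableE gs s :
  table (image_word gs) (records (table_word s)) =
  table_word (retract (images gs) s).
Proof.
rewrite /table {2}recordsE foldblk_blocks ?comma_record // /table_word.
set E := records _.
have -> : enum 'I_n = rev (rev (enum 'I_n)) by rewrite revK.
rewrite [in LHS]revK.
elim: (rev (enum _)) => //= q l IH.
rewrite before_record after_record lookupE IH rev_cons -cats1 map_cat blocks_cat.
by rewrite blocks_cons.
Qed.

Lemma fixesE gs s :
  fixes (image_word gs) (records (table_word s)) = fixes_set (images gs) s.
Proof.
rewrite /fixes {2}recordsE foldblk_blocks ?comma_record //.
rewrite (_ : fixes_set _ _ = all (fun q => (q \in images gs) ==>
  (retract (images gs) s q == q)) (rev (enum 'I_n))); last first.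
  apply/forallP/allP => h q; first by move=> _; apply: h.
  by apply: h; rewrite mem_rev mem_enum.
elim: (rev _) => //= q l IH.
rewrite before_record after_record mem_image_word lookupE (inj_eq point_inj).
by rewrite -IH; case: (q \in _) => //=; case: eqP.
Qed.

Lemma list_right_identitiesE gs :
  list_right_identities (image_word gs) (encode_tables gs) =
  encode_tables (right_identities gs).
Proof.
rewrite /list_right_identities !encode_tablesE foldblk_blocks ?semicolon_tables //.
have hf := fixesE gs; have ht := tableE gs; rewrite /right_identities.
(* The image set and its word come from all generators and must stay fixed while the induction
   shortens the list. *)
move: (images gs) (image_word gs) hf ht => I V hf ht; elim: gs => //= s gs ->.
rewrite hf ht mem_blkE ?semicolon_tables // (mem_map table_word_inj).
by case: ifP => //= _; rewrite blocks_cons.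
Qed.

End Semantics.

Lemma solveE x :
  solve (encode_generators x) = encode_tables (right_identities (gens x)).
Proof.
rewrite /solve /encode_generators -!cats1 -!catA /= !after_cat;
  try exact/semicolon_bits/bits_binary.
by rewrite filter_tables list_right_identitiesE.
Qed.

(** * Right identities as retractions along generators *)

Section RightIdentities.
Variables (n : nat) (gs : seq (transf n)).
Implicit Types (s t r : transf n) (p q : 'I_n).
Local Notation I := (images gs).
Local Notation S := (subsemigroup_gen gs).

Lemma mem_images s q : s \in gs -> s q \in I.
Proof. by move=> s_gs; rewrite inE; apply/hasP; exists s; rewrite ?codom_f. Qed.

Lemma mul_transfE s t q : (s * t)%g q = t (s q).
Proof. by rewrite /mul /= ffunE. Qed.

Lemma gen_images s q : S s -> s q \in I.
Proof.
move=> Ss; elim: Ss q => {s} [s /mem_images //|s t _ _ _ IH q].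
by rewrite mul_transfE.
Qed.

(** The factor g is a mere function: for a generator it is the identity, which need not lie in the
    semigroup. *)
Lemma gen_split r : S r -> exists2 s, s \in gs & exists g : 'I_n -> 'I_n,
  forall q, r q = g (s q).
Proof.
elim=> [s s_gs|s' t _ [s s_gs [g rE]] _ _]; exists s => //; first by exists id.
by exists (t \o g) => q; rewrite mul_transfE rE.
Qed.

Lemma right_identityP r :
  right_identity S r <-> S r /\ {in I, forall p, r p = p}.
Proof.
split=> -[Sr h]; split=> //.
  move=> p; rewrite inE => /hasP[s s_gs /codomP[q ->]].
  by rewrite -mul_transfE h //; apply: Gen_base.
by move=> s Ss; apply/ffunP => q; rewrite mul_transfE h ?gen_images.
Qed.

Lemma retract_spec (J : {set 'I_n}) s q :
  [/\ retract J s q \in J & s (retract J s q) = s q] \/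
  retract J s q = q /\ {in J, forall p, s p <> s q}.
Proof.
rewrite ffunE.
have : rev (enum 'I_n) =i 'I_n by move=> p; rewrite mem_rev mem_enum.
move: (rev _) => l mem_l.
suff [[]|[-> h]] :
  let f := foldr (fun p c => if (s p == s q) && (p \in J) then p else c) q l in
  [/\ f \in J & s f = s q] \/ f = q /\ {in l, forall p, p \in J -> s p <> s q}.
- by left.
- by right; split=> // p; apply: h; rewrite mem_l.
elim: l {mem_l} => /= [|p l IH]; first by right.
case: ifP => [/andP[/eqP ? ?]|np]; first by left.
case: IH => [|[-> h]]; [by left | right; split=> // p'].
rewrite inE => /predU1P[-> p_J E|]; last exact: h.
by rewrite E eqxx p_J in np.
Qed.

Lemma retractE (J : {set 'I_n}) s p q : {in J &, injective s} ->
  p \in J -> s p = s q -> retract J s q = p.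
Proof.
move=> inj_s p_J spq; case: (retract_spec J s q) => [[r_J Er]|[_ /(_ p p_J)//]].
by apply: inj_s => //; rewrite Er.
Qed.

(** If p and q in J have the same image under s, the folds for both make the same choices and meet
    the match p, so their different defaults are never returned. Hence their retracts, p and q,
    coincide. *)
Lemma fixes_setP (J : {set 'I_n}) s :
  reflect {in J &, injective s} (fixes_set J s).
Proof.
apply: (iffP forall_inP) => [fix_r p q p_J q_J spq | inj_s q q_J]; last first.
  by apply/eqP/retractE.
rewrite -[p](eqP (fix_r p p_J)) -[q in RHS](eqP (fix_r q q_J)) !ffunE spq.
have : p \in rev (enum 'I_n) by rewrite mem_rev mem_enum.
elim: (rev _) => //= p' l IH; rewrite inE => /predU1P[<-|/IH ->] //.
by rewrite spq eqxx p_J.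
Qed.

(** Pigeonhole on the powers of s among finitely many maps, then cancellation by injectivity on
    I. *)
Lemma period s : s \in gs -> {in I &, injective s} ->
  exists m, {in I, forall p, iter m.+1 s p = p}.
Proof.
move=> s_gs inj_s.
have iterI m p : p \in I -> iter m s p \in I.
  by case: m => //= m _; apply: mem_images.
have inj_iter m : {in I &, injective (iter m s)}.
  elim: m => //= m IH p q p_I q_I E; apply: IH => //.
  by apply: inj_s E; apply: iterI.
pose pw (i : 'I_#|{: transf n}|.+1) : transf n := [ffun q => iter i s q].
have [i [j [lt_ij Eij]]] :
    exists i j : 'I_#|{: transf n}|.+1, i < j /\ pw i = pw j.
  have /injectivePn [i [j ne_ij Eij]] : ~~ injectiveb pw.
    by apply/negP => /injectiveP/leq_card; rewrite card_ord ltnn.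
  have [lt_ij|lt_ji|/val_inj E] := ltngtP i j; last by rewrite E eqxx in ne_ij.
    by exists i, j.
  by exists j, i.
(* The exponent is m + 1 = j - i; it is positive, so that the power lies in the semigroup. *)
exists (j - i).-1; rewrite prednK ?subn_gt0 // => p p_I.
apply: (inj_iter i); rewrite ?iterI // -iterD subnKC 1?ltnW //.
by move/ffunP: Eij => /(_ p); rewrite !ffunE.
Qed.

Lemma power_gen s m : s \in gs ->
  exists2 r, S r & forall q, r q = iter m.+1 s q.
Proof.
move=> s_gs; elim: m => [|m [r Sr rE]]; first by exists s => //; apply: Gen_base.
exists (r * s)%g => [|q]; first by apply: Gen_mul => //; apply: Gen_base.
by rewrite mul_transfE rE.
Qed.

Lemma right_identity_retract s : s \in gs -> fixes_set I s ->
  right_identity S (retract I s).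
Proof.
move=> s_gs /fixes_setP inj_s; apply/right_identityP.
have [m per] := period s_gs inj_s; have [r Sr rE] := power_gen m s_gs.
have fix_r : {in I, forall p, r p = p} by move=> p p_I; rewrite rE per.
suff -> : retract I s = r by [].
apply/ffunP => q; apply: retractE => //; first exact: gen_images.
(* s (r q) is the power m + 1 of s applied to s q, which lies in I and is therefore fixed. *)
by rewrite rE -iterS iterSr per // mem_images.
Qed.

Lemma retract_right_identity r : right_identity S r ->
  exists2 s, s \in gs & fixes_set I s /\ r = retract I s.
Proof.
move/right_identityP => [Sr fix_r]; have [s s_gs [g rE]] := gen_split Sr.
exists s => //.
have inj_s : {in I &, injective s}.
  by move=> p q p_I q_I E; rewrite -(fix_r p) // -(fix_r q) // !rE E.
split; first exact/fixes_setP.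
apply/ffunP => q; apply/esym/retractE => //; first exact: gen_images.
have [m per] := period s_gs inj_s.
(* On I, both g and the m-th power of s invert s: p is s applied to its m-th iterate, and r, which
   is s followed by g, fixes that iterate. *)
have gE p : p \in I -> g p = iter m s p.
  move=> p_I; have im_I : iter m s p \in I.
    by case: (m) => //= k; apply: mem_images.
  by rewrite -[in LHS](per p p_I) iterS -rE fix_r.
(* This is r (r q) = r q, valid because r q lies in I. Replacing g by the m-th power and applying s
   once more gives s (r q) = s q. *)
have E : g (s (r q)) = g (s q) by rewrite -rE fix_r ?rE // -rE gen_images.
rewrite !gE ?mem_images // in E.
by rewrite -(per (s (r q))) ?mem_images // iterS E -iterS per ?mem_images.
Qed.

Lemma right_identities_spec :
  uniq (right_identities gs) /\
  forall r, r \in right_identities gs <-> right_identity S r.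
Proof.
have mem_r r : r \in right_identities gs =
    has (fun s => fixes_set I s && (r == retract I s)) gs.
  rewrite /right_identities; move: (images gs) => J; elim: gs => //= s l IH.
  case: (fixes_set J s) => //=; rewrite -IH.
  by case: ifPn; rewrite ?inE // negbK => rs_l; case: eqP => // ->.
split.
  rewrite /right_identities; move: (images gs) => J; elim: gs => //= s l IH.
  by case: ifP => //= /andP[_ ->].
move=> r; rewrite mem_r; split.
  by case/hasP=> s s_gs /andP[fs /eqP ->]; apply: right_identity_retract.
case/retract_right_identity=> s s_gs [fs ->].
  by apply/hasP; exists s; rewrite ?fs /=.
Qed.
End RightIdentities.

Theorem theorem6p4 :
  @computable_in_poly_time letter generators
    (fun x => seq (transf (degree x)))
    encode_generators
    (fun x l => encode_tables l)
    lists_right_identities.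
Proof.
(* With base 1, stack 0 is the input and stack 1 receives the result, matching the tapes of
   [machine_of]; taking [maxn 1 K] below ensures that tape 1 exists. *)
have [p [B [P hP] hp]] := pt_prog polytime_solve (leqnn 1).
have [K vK] := vars_le_ex p.
exists (machine_of (maxn 1 K) p), P => x.
exists (right_identities (gens x)); first exact: right_identities_spec.
pose s i := if i is 0 then encode_generators x else [::].
have [|t le_t rt] := hp s; first by case.
have := @machine_of_correct (maxn 1 K) p s t _ _ (leq_maxl _ _) rt.
rewrite /(upd _ _ _ _) eqxx solveE => -[||m le_m hm].
- exact: vars_le_trans (leq_maxr _ _) vK.
- by case.
exists m => //; apply: leq_trans le_m (leq_trans le_t _).
(* [tot 1 s] is the length of the input word, the argument at which P has to be evaluated. *)
by rewrite hP /tot big_ord1.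
Qed.
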